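(* Let $\mu,k>0$, $\gamma\ge1$, a shock speed $s\ne0$ and $R^->0$ be fixed. There exists a sufficiently small $\varepsilon_0>0$ such that: (a) If $s>0$ and $0<R^--R^+<\varepsilon_0$, then there exists a heteroclinic trajectory $R$ of $$R''=\frac{2}{k^2}f(R)-\frac{2s\mu}{k^2}R'+\frac{(R')^2}{2R}\qquad( * )$$ connecting the equilibria $(R^-,0)$ (as $x\to-\infty$) to $(R^+,0)$ (as $x\to+\infty$) in the $(R,R')$-phase plane, which is monotone decreasing with $R'(x)<0$ for all $x\in\mathbb R$. (b) If $s<0$ and $0<R^+-R^-<\varepsilon_0$, then there exists a heteroclinic trajectory $R$ of $( * )$ connecting $(R^-,0)$ (as $x\to-\infty$) to $(R^+,0)$ (as $x\to+\infty$), which is monotone increasing with $R'(x)>0$ for all $x\in\mathbb R$. In both cases, with $\varepsilon=|R^+-R^-|$, $$|R'(x)|\le C\varepsilon^2,\qquad |R''(x)|\le C\varepsilon|R'(x)|,$$ for all $x\in\mathbb R$ and for some uniform constant $C>0$ (independent of $\varepsilon$).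
   Context: The enthalpy is $h(\rho)=\ln\rho$ if $\gamma=1$ and $h(\rho)=\frac{\gamma}{\gamma-1}\rho^{\gamma-1}$ if $\gamma>1$. For $R^\pm>0$, $R^+\neq R^-$, the function $f$ (depending on $R^\pm$) is defined for $R>0$ by $$f(R)=\frac{R}{R^++R^-}\left[\frac{(R^+R^-)^2}{R^2}\cdot\frac{h(R^+)-h(R^-)}{R^+-R^-}+(R^++R^-)h(R)-\frac{(R^+)^2h(R^+)-(R^-)^2h(R^-)}{R^+-R^-}\right].$$ The equation $( * )$ is the density profile equation for travelling waves (dispersive shock profiles) of the quantum hydrodynamics system $\rho_t+(\rho u)_x=0$, $u_t+(\frac12u^2+h(\rho))_x=\epsilon\mu\big(\frac{(\rho u)_x}{\rho}\big)_x+\epsilon^2k^2\big(\frac{(\sqrt\rho)_{xx}}{\sqrt\rho}\big)_x$ moving with speed $s$, where $'=d/dx$ and $x$ is the rescaled Galilean variable. Solutions are positive, $R(x)>0$, with $R^\pm>0$. *)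

(* Defs.v *)
From Stdlib Require Import Reals.
From Coquelicot Require Import Coquelicot.
Open Scope R_scope.

(* Only evaluated at rho > 0: there [Rpower rho a] is rho^a. *)
Definition enthalpy (gamma rho : R) : R :=
  if Req_EM_T gamma 1 then ln rho
  else gamma / (gamma - 1) * Rpower rho (gamma - 1).

(* [Rm] and [Rp] are the end states R^- and R^+. *)
Definition profile_f (gamma Rm Rp r : R) : R :=
  let h := enthalpy gamma in
  r / (Rp + Rm) *
  ((Rp * Rm) ^ 2 / r ^ 2 * ((h Rp - h Rm) / (Rp - Rm))
   + (Rp + Rm) * h r
   - (Rp ^ 2 * h Rp - Rm ^ 2 * h Rm) / (Rp - Rm)).

(* Right-hand side of R'' = G(R, R') for the profile equation. *)
Definition profile_rhs (gamma mu k s Rm Rp r p : R) : R :=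
  2 / k ^ 2 * profile_f gamma Rm Rp r
  - 2 * s * mu / k ^ 2 * p
  + p ^ 2 / (2 * r).

(* The second derivative is [Derive_n u 2]. Since [Derive] is total,
   [ex_derive_n u 2 x] alone does not give differentiability of u itself, so
   both orders are required. *)
Definition positive_solution (G : R -> R -> R) (u : R -> R) : Prop :=
  forall x : R,
    0 < u x /\ ex_derive u x /\ ex_derive_n u 2 x /\
    Derive_n u 2 x = G (u x) (Derive u x).

(* (r, p) is a rest point of the planar system u' = v, v' = G(u, v). *)
Definition equilibrium (G : R -> R -> R) (r p : R) : Prop :=
  p = 0 /\ G r p = 0.

Definition heteroclinic (G : R -> R -> R) (a b : R) (u : R -> R) : Prop :=
  positive_solution G u /\
  equilibrium G a 0 /\ equilibrium G b 0 /\
  is_lim u m_infty a /\ is_lim (Derive u) m_infty 0 /\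
  is_lim u p_infty b /\ is_lim (Derive u) p_infty 0.

Definition profile_bounds (C eps : R) (u : R -> R) : Prop :=
  forall x : R,
    Rabs (Derive u x) <= C * eps ^ 2 /\
    Rabs (Derive_n u 2 x) <= C * eps * Rabs (Derive u x).

(* Main.v *)
(* Write F = (2/k^2) f and a = 2 s mu / k^2 > 0; the case s < 0 follows by x -> -x.
   Between its zeros R^+ and R^- the function F is negative and |F'| = O(eps).
   Parametrize the profile by the orbit R0' = F(R0) joining R^- to R^+, and let
   dx/dt = r(t).  Then R(x(t)) = R0(t) solves the profile equation iff
     r' = r (b + a r - r^2),   b = F'(R0) - F(R0) / (2 R0) = O(eps).
   This scalar equation is attracted to r = a at rate about a^2: inverting r' + 2 a^2 r
   on bounded functions of t turns it into a contraction, so it has an entire solution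
   with |r - a| = O(eps).  Since R' = F(R) / r and R'' = R' (F'(R) - r'/r) / r, the
   estimates follow. *)

Require Import Defs.
From Stdlib Require Import Reals Ranalysis5 Lra Lia ClassicalEpsilon.
From Coquelicot Require Import Coquelicot.
Open Scope R_scope.

(** As eps tends to 0 the two rest points merge and one eigenvalue at each tends to 0, so
    linearizing the planar system at the end states gives no uniform control. The rate equation does
    not see this degeneracy: its attraction rate stays near a^2 for every eps. It comes without an
    initial condition; boundedness on the whole line takes its place. The equations actually solved
    are then quadratures and linear equations with an explicit integrating factor. Smallness has a
    Rolle-type origin. f is R times a function g that vanishes at both end states, so g' vanishes at
    some z between them. Hence g' = O(eps) and g = O(eps^2): the first order controls F' and b, the
    second yields the bound on R'. The constants are uniform because both end states stay in a fixed
    compact subinterval of the positive axis. *)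

(** * Calculus on the line: monotonicity, continuity, inverse functions *)

Lemma mean_value (f df : R -> R) (a b : R) :
  a < b -> (forall x, a <= x <= b -> is_derive f x (df x)) ->
  exists xi, a < xi < b /\ f b - f a = df xi * (b - a).
Proof.
  intros Hab Hf.
  destruct (MVT_cor2 f df a b Hab) as [xi [H1 H2]].
  - intros x Hx. apply is_derive_Reals, Hf, Hx.
  - exists xi. split; assumption.
Qed.

Lemma nondecreasing_of_derive (f df : R -> R) (a b : R) :
  a <= b -> (forall x, a <= x <= b -> is_derive f x (df x)) ->
  (forall x, a <= x <= b -> 0 <= df x) -> f a <= f b.
Proof.
  intros [Hab | ->] Hf Hpos; [| lra].
  destruct (mean_value f df a b Hab Hf) as [xi [H1 H2]].
  assert (0 <= df xi) by (apply Hpos; lra). nra.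
Qed.

Lemma increasing_of_derive (f df : R -> R) (a b : R) :
  a < b -> (forall x, a <= x <= b -> is_derive f x (df x)) ->
  (forall x, a < x < b -> 0 < df x) -> f a < f b.
Proof.
  intros Hab Hf Hpos.
  destruct (mean_value f df a b Hab Hf) as [xi [H1 H2]].
  assert (0 < df xi) by (apply Hpos; lra). nra.
Qed.

Lemma choice_fun (A B : Type) (P : A -> B -> Prop) :
  (forall x, exists y, P x y) -> exists f : A -> B, forall x, P x (f x).
Proof.
  intros H.
  exists (fun x => proj1_sig (constructive_indefinite_description _ (H x))).
  intros x. apply proj2_sig.
Qed.

Lemma continuous_eps (f : R -> R) (x : R) :
  continuous f x <->
  forall eps, 0 < eps -> exists delta, 0 < delta /\
    forall y, Rabs (y - x) < delta -> Rabs (f y - f x) < eps.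
Proof.
  split.
  - intros H eps Heps.
    destruct (proj1 (filterlim_locally f (f x)) H (mkposreal eps Heps)) as [d Hd].
    exists d. split; [apply cond_pos |]. intros y Hy. exact (Hd y Hy).
  - intros H. apply filterlim_locally. intros eps.
    destruct (H eps (cond_pos eps)) as [d [Hd0 Hd]].
    exists (mkposreal d Hd0). intros y Hy. exact (Hd y Hy).
Qed.

Lemma is_derive_continuous (f : R -> R) (x l : R) :
  is_derive f x l -> continuous f x.
Proof.
  intros H. apply (ex_derive_continuous (V := R_NormedModule)). exists l. exact H.
Qed.

(** The predicate [D] lets one statement serve both an open interval and the whole line.
    Surjectivity is left to the caller, who proves it by a growth estimate; the last conclusion is
    what makes [theta] onto [D]. *)
Lemma inverse_function (D : R -> Prop) (X rho : R -> R) :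
  (forall s, D s -> locally s D) ->
  (forall a b s, D a -> D b -> a <= s <= b -> D s) ->
  (forall s, D s -> is_derive X s (rho s)) ->
  (forall s, D s -> 0 < rho s) ->
  (forall x, exists s, D s /\ X s = x) ->
  exists theta : R -> R,
    (forall x, D (theta x) /\ X (theta x) = x /\
       is_derive theta x (/ rho (theta x))) /\
    (forall s, D s -> theta (X s) = s).
Proof.
  intros Hopen Hconv HX Hrho Hsurj.
  destruct (choice_fun _ _ _ Hsurj) as [theta Htheta].
  assert (Hincr : forall s t, D s -> D t -> s < t -> X s < X t).
  { intros s t Hs Ht Hst. apply (increasing_of_derive X rho); [exact Hst | |].
    - intros y Hy. apply HX, (Hconv s t); assumption.
    - intros y Hy. apply Hrho, (Hconv s t); [assumption .. | lra]. }
  assert (Hmono : forall x y, x < y -> theta x < theta y).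
  { intros x y Hxy. destruct (Htheta x) as [Dx Ex], (Htheta y) as [Dy Ey].
    destruct (Rtotal_order (theta x) (theta y)) as [H | [H | H]]; [exact H | |].
    - rewrite H in Ex. lra.
    - specialize (Hincr _ _ Dy Dx H). lra. }
  assert (Hcont : forall x, continuous theta x).
  { intros x. apply continuous_eps. intros eps Heps.
    destruct (Htheta x) as [Dx Ex].
    destruct (Hopen _ Dx) as [d Hd].
    set (e := Rmin (eps / 2) (d / 2)).
    assert (He : 0 < e <= eps / 2 /\ e <= d / 2).
    { generalize (cond_pos d); intros Hd0. unfold e.
      repeat split; [apply Rmin_pos; lra | apply Rmin_l | apply Rmin_r]. }
    assert (Hball : forall t, Rabs (t - theta x) <= e -> D t).
    { intros t Ht. apply Hd. change (Rabs (t - theta x) < d).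
      generalize (cond_pos d); lra. }
    assert (D1 : D (theta x - e)).
    { apply Hball. replace (theta x - e - theta x) with (- e) by ring.
      rewrite Rabs_Ropp, Rabs_pos_eq; lra. }
    assert (D2 : D (theta x + e)).
    { apply Hball. replace (theta x + e - theta x) with e by ring.
      rewrite Rabs_pos_eq; lra. }
    assert (H1 : X (theta x - e) < x) by (rewrite <- Ex at 2; apply Hincr; [assumption .. | lra]).
    assert (H2 : x < X (theta x + e)) by (rewrite <- Ex at 1; apply Hincr; [assumption .. | lra]).
    exists (Rmin (x - X (theta x - e)) (X (theta x + e) - x)).
    split; [apply Rmin_pos; lra |].
    intros y Hy. destruct (Htheta y) as [Dy Ey].
    generalize (Rmin_l (x - X (theta x - e)) (X (theta x + e) - x));
    generalize (Rmin_r (x - X (theta x - e)) (X (theta x + e) - x)); intros M1 M2.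
    apply Rabs_def2 in Hy.
    assert (theta x - e < theta y).
    { destruct (Rtotal_order (theta x - e) (theta y)) as [H | [H | H]]; [exact H | |].
      - rewrite H in *. lra.
      - specialize (Hincr _ _ Dy D1 H). lra. }
    assert (theta y < theta x + e).
    { destruct (Rtotal_order (theta y) (theta x + e)) as [H' | [H' | H']]; [exact H' | |].
      - rewrite <- H' in *. lra.
      - specialize (Hincr _ _ D2 Dy H'). lra. }
    apply Rabs_def1; lra. }
  exists theta. split; cycle 1.
  { intros s Ds. destruct (Htheta (X s)) as [Dx Ex].
    destruct (Rtotal_order (theta (X s)) s) as [H | [H | H]]; [| exact H |].
    - specialize (Hincr _ _ Dx Ds H). lra.
    - specialize (Hincr _ _ Ds Dx H). lra. }
  intros x. destruct (Htheta x) as [Dx Ex].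
  split; [exact Dx | split; [exact Ex |]].
  apply is_derive_Reals. intros eps Heps.
  generalize (Hrho _ Dx); intros Hr.
  (* The difference quotient j/h of [theta] is the reciprocal of the quotient h/j of [X] with
     increment j, so continuity of inversion at [rho (theta x)] transfers the limit. *)
  assert (Hinv : continuous Rinv (rho (theta x))) by (apply continuous_Rinv; lra).
  destruct (proj1 (continuous_eps _ _) Hinv eps Heps) as [d1 [Hd1 Hinv1]].
  destruct (proj1 (is_derive_Reals _ _ _) (HX _ Dx) d1 Hd1) as [d2 Hd2].
  destruct (proj1 (continuous_eps _ _) (Hcont x) d2 (cond_pos d2)) as [d3 [Hd3 Hc]].
  exists (mkposreal d3 Hd3). intros h Hh0 Hh. simpl in Hh.
  destruct (Htheta (x + h)) as [Dh Eh].
  set (j := theta (x + h) - theta x).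
  assert (Hj : j <> 0).
  { unfold j. intros Hj. replace (theta (x + h)) with (theta x) in Eh by lra. lra. }
  assert (Hjs : Rabs j < d2).
  { apply Hc. replace (x + h - x) with h by ring. exact Hh. }
  specialize (Hd2 j Hj Hjs).
  replace (theta x + j) with (theta (x + h)) in Hd2 by (unfold j; ring).
  rewrite Eh, Ex in Hd2.
  replace (x + h - x) with h in Hd2 by ring.
  specialize (Hinv1 _ Hd2).
  replace (j / h) with (/ (h / j)) by (field; split; assumption).
  exact Hinv1.
Qed.

(** * Bounded solutions on the whole line of scalar equations *)

Lemma antiderivative (f : R -> R) :
  (forall t, continuous f t) -> exists J, forall t, is_derive J t (f t).
Proof.
  intros Hf. exists (fun t => RInt f 0 t). intros t.
  apply (is_derive_RInt f (fun t => RInt f 0 t) 0 t).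
  - exists (mkposreal 1 Rlt_0_1). intros y _.
    apply (RInt_correct f), ex_RInt_continuous. intros z _. apply Hf.
  - apply Hf.
Qed.

(** The solution is the integral of exp(-K(t-s)) phi(s) over s < t, obtained without an improper
    integral. With J' = exp(Kt) phi, the function J - M exp(Kt)/K is nonincreasing, J - m exp(Kt)/K
    is nondecreasing, and every value of the first lies below every value of the second. A number A
    separating them gives v = (J - A) exp(-Kt), and the separation is exactly the bound on v. *)
Lemma linear_bounded_solution (K m M : R) (phi : R -> R) :
  0 < K -> (forall t, continuous phi t) -> (forall t, m <= phi t <= M) ->
  exists v, forall t,
    is_derive v t (phi t - K * v t) /\ m / K <= v t <= M / K.
Proof.
  intros HK Hc Hb.
  assert (Hmul : forall t : R, is_derive (fun t => exp (K * t)) t (K * exp (K * t))).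
  { intros t. auto_derive; [exact I | ring]. }
  destruct (antiderivative (fun t => exp (K * t) * phi t)) as [J HJ].
  { intros t. apply (continuous_mult (fun t => exp (K * t)) phi); [| apply Hc].
    exact (is_derive_continuous _ _ _ (Hmul t)). }
  assert (Hlin : forall c t, is_derive (fun t => J t - c * exp (K * t) / K) t
                   (exp (K * t) * (phi t - c))).
  { intros c t. auto_derive.
    - exists (exp (K * t) * phi t). apply HJ.
    - replace (Derive (fun x => J x) t) with (exp (K * t) * phi t)
        by (symmetry; apply is_derive_unique, HJ). field. lra. }
  assert (Hup : forall s t, s <= t ->
            J t - M * exp (K * t) / K <= J s - M * exp (K * s) / K).
  { intros s t Hst. apply Ropp_le_cancel.
    apply (nondecreasing_of_derive (fun t => - (J t - M * exp (K * t) / K))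
             (fun t => - (exp (K * t) * (phi t - M)))); [exact Hst | |].
    - intros x _. exact (is_derive_opp (V := R_NormedModule) _ _ _ (Hlin M x)).
    - intros x _. generalize (exp_pos (K * x)) (Hb x). nra. }
  assert (Hlo : forall s t, s <= t ->
            J s - m * exp (K * s) / K <= J t - m * exp (K * t) / K).
  { intros s t Hst.
    apply (nondecreasing_of_derive (fun t => J t - m * exp (K * t) / K)
             (fun t => exp (K * t) * (phi t - m))); [exact Hst | |].
    - intros x _. exact (Hlin m x).
    - intros x _. generalize (exp_pos (K * x)) (Hb x). nra. }
  assert (Hsep : forall s t,
            J s - M * exp (K * s) / K <= J t - m * exp (K * t) / K).
  { intros s t.
    generalize (Hup _ _ (Rmin_l s t)) (Hlo _ _ (Rmin_r s t)).
    generalize (Rmin s t); intros w H1 H2.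
    enough (m * exp (K * w) / K <= M * exp (K * w) / K) by lra.
    apply Rmult_le_compat_r; [left; apply Rinv_0_lt_compat, HK |].
    apply Rmult_le_compat_r; [left; apply exp_pos |].
    generalize (Hb 0). lra. }
  (* [A] plays the role of the limit of [J] at minus infinity. *)
  destruct (completeness (fun z => exists s, z = J s - M * exp (K * s) / K)) as [A [HA1 HA2]].
  - exists (J 0 - m * exp (K * 0) / K). intros z [s ->]. apply Hsep.
  - exists (J 0 - M * exp (K * 0) / K), 0. reflexivity.
  - assert (HA : forall t, J t - M * exp (K * t) / K <= A <= J t - m * exp (K * t) / K).
    { intros t. split.
      - apply HA1. exists t. reflexivity.
      - apply HA2. intros z [s ->]. apply Hsep. }
    exists (fun t => (J t - A) / exp (K * t)). intros t.
    generalize (exp_pos (K * t)) (HA t); intros He [H1 H2].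
    split.
    + auto_derive.
      * split; [exists (exp (K * t) * phi t); apply HJ | split; [lra | exact I]].
      * replace (Derive (fun x => J x) t) with (exp (K * t) * phi t)
          by (symmetry; apply is_derive_unique, HJ). field. lra.
    + split.
      * apply (Rmult_le_reg_r (exp (K * t))); [exact He |].
        replace ((J t - A) / exp (K * t) * exp (K * t)) with (J t - A) by (field; lra).
        replace (m / K * exp (K * t)) with (m * exp (K * t) / K) by (field; lra). lra.
      * apply (Rmult_le_reg_r (exp (K * t))); [exact He |].
        replace ((J t - A) / exp (K * t) * exp (K * t)) with (J t - A) by (field; lra).
        replace (M / K * exp (K * t)) with (M * exp (K * t) / K) by (field; lra). lra.
Qed.

(** An excess of v over delta/K at one time would grow at least like exp(K(t-s)) when followed
    backwards to s, since exp(Kt)(v - delta/K) is nonincreasing; this contradicts the bound B. *)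
Lemma bounded_upper_bound (K B delta : R) (v w : R -> R) :
  0 < K -> (forall t, is_derive v t (w t - K * v t)) ->
  (forall t, v t <= B) -> (forall t, w t <= delta) ->
  forall t, v t <= delta / K.
Proof.
  intros HK Hv HB Hw t.
  apply Rnot_lt_le. intros Hlt.
  assert (Hmono : forall s, s <= t ->
            exp (K * t) * (v t - delta / K) <= exp (K * s) * (v s - delta / K)).
  { intros s Hs. apply Ropp_le_cancel.
    apply (nondecreasing_of_derive (fun t => - (exp (K * t) * (v t - delta / K)))
             (fun t => exp (K * t) * (delta - w t))); [exact Hs | |].
    - intros x _. auto_derive.
      + exists (w x - K * v x). apply Hv.
      + replace (Derive (fun x => v x) x) with (w x - K * v x)
          by (symmetry; apply is_derive_unique, Hv). field. lra.
    - intros x _. generalize (exp_pos (K * x)) (Hw x). nra. }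
  set (eta := v t - delta / K) in *.
  assert (Heta : 0 < eta) by (unfold eta; lra).
  (* The maximum with 1 keeps [B'] positive, so that the time s below lies before t. *)
  set (B' := Rmax 1 (B - delta / K)).
  assert (HB' : 0 < B') by (generalize (Rmax_l 1 (B - delta / K)); unfold B'; lra).
  (* [exp (K (t - s)) >= 1 + K (t - s) > B' / eta] for this [s]. *)
  set (s := t - B' / (eta * K)).
  assert (Hq : 0 < B' / (eta * K)) by (apply Rdiv_lt_0_compat; nra).
  assert (Hs : s <= t) by (unfold s; lra).
  specialize (Hmono s Hs).
  assert (Hvs : v s - delta / K <= B').
  { unfold B'. generalize (Rmax_r 1 (B - delta / K)) (HB s). lra. }
  assert (Hexp : exp (K * t) = exp (K * s) * exp (B' / eta)).
  { rewrite <- exp_plus. f_equal. unfold s. field. split; lra. }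
  assert (Hbe : 0 < B' / eta) by (apply Rdiv_lt_0_compat; lra).
  assert (Hbig : 1 + B' / eta < exp (B' / eta)) by (apply exp_ineq1; lra).
  assert (Hbe' : B' / eta * eta = B') by (field; lra).
  rewrite Hexp in Hmono.
  generalize (exp_pos (K * s)); intros Hes.
  assert (exp (K * s) * (exp (B' / eta) * eta) <= exp (K * s) * B') by nra.
  assert (exp (B' / eta) * eta <= B') by (apply (Rmult_le_reg_l (exp (K * s))); assumption).
  nra.
Qed.

(** The bound B only excludes the homogeneous solutions exp(-Kt) and is absent from the conclusion:
    the map from right-hand side to bounded solution has Lipschitz constant 1/K in the sup norm. *)
Lemma bounded_solutions_close (K B delta : R) (v1 v2 w1 w2 : R -> R) :
  0 < K ->
  (forall t, is_derive v1 t (w1 t - K * v1 t)) ->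
  (forall t, is_derive v2 t (w2 t - K * v2 t)) ->
  (forall t, Rabs (v1 t - v2 t) <= B) ->
  (forall t, Rabs (w1 t - w2 t) <= delta) ->
  forall t, Rabs (v1 t - v2 t) <= delta / K.
Proof.
  intros HK H1 H2 HB Hd t.
  assert (D1 : forall t, is_derive (fun t => v1 t - v2 t) t
                 (w1 t - w2 t - K * (v1 t - v2 t))).
  { intros x. replace (w1 x - w2 x - K * (v1 x - v2 x))
      with (minus (w1 x - K * v1 x) (w2 x - K * v2 x)) by (unfold minus, plus, opp; simpl; ring).
    exact (is_derive_minus (V := R_NormedModule) _ _ _ _ _ (H1 x) (H2 x)). }
  assert (D2 : forall t, is_derive (fun t => v2 t - v1 t) t
                 (w2 t - w1 t - K * (v2 t - v1 t))).
  { intros x. replace (w2 x - w1 x - K * (v2 x - v1 x))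
      with (minus (w2 x - K * v2 x) (w1 x - K * v1 x)) by (unfold minus, plus, opp; simpl; ring).
    exact (is_derive_minus (V := R_NormedModule) _ _ _ _ _ (H2 x) (H1 x)). }
  apply Rabs_le. split.
  - enough (v2 t - v1 t <= delta / K) by lra.
    apply (bounded_upper_bound K B delta (fun t => v2 t - v1 t) (fun t => w2 t - w1 t) HK D2).
    + intros x. generalize (proj1 (Rabs_le_between _ _) (HB x)). lra.
    + intros x. generalize (proj1 (Rabs_le_between _ _) (Hd x)). lra.
  - apply (bounded_upper_bound K B delta (fun t => v1 t - v2 t) (fun t => w1 t - w2 t) HK D1).
    + intros x. generalize (proj1 (Rabs_le_between _ _) (HB x)). lra.
    + intros x. generalize (proj1 (Rabs_le_between _ _) (Hd x)). lra.
Qed.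

Lemma uniform_limit_continuous (q : nat -> R -> R) (l : R -> R) (e : nat -> R) :
  (forall n t, continuous (q n) t) ->
  (forall n t, Rabs (q n t - l t) <= e n) ->
  (forall eps, 0 < eps -> exists n, e n < eps) ->
  forall t, continuous l t.
Proof.
  intros Hc Hl He t. apply continuous_eps. intros eps Heps.
  destruct (He (eps / 3)) as [n Hn]; [lra |].
  destruct (proj1 (continuous_eps _ _) (Hc n t) (eps / 3)) as [d [Hd Hq]]; [lra |].
  exists d. split; [exact Hd |]. intros y Hy.
  specialize (Hq y Hy). apply Rabs_def2 in Hq.
  generalize (proj1 (Rabs_le_between _ _) (Hl n y))
    (proj1 (Rabs_le_between _ _) (Hl n t)); intros A1 A2.
  apply Rabs_def1; lra.
Qed.

(** Banach iteration in the sup norm for the map sending q to the bounded solution of v' = Psi(t, q)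
    - K v. The factor 1/K of the linear solution operator cancels the K in the Lipschitz constant of
    [Psi], leaving [theta]. *)
Lemma entire_bounded_solution (K theta lo hi : R) (Psi : R -> R -> R) :
  0 < K -> 0 <= theta < 1 -> lo <= hi ->
  (forall q : R -> R, (forall t, continuous q t) ->
     forall t, continuous (fun t => Psi t (q t)) t) ->
  (forall t q, lo <= q <= hi -> K * lo <= Psi t q <= K * hi) ->
  (forall t p q, lo <= p <= hi -> lo <= q <= hi ->
     Rabs (Psi t p - Psi t q) <= theta * K * Rabs (p - q)) ->
  exists q, forall t, is_derive q t (Psi t (q t) - K * q t) /\ lo <= q t <= hi.
Proof.
  intros HK Hth Hlh Hcont Hmap Hlip.
  set (ok := fun q : R -> R =>
    (forall t, continuous q t) /\ (forall t, lo <= q t <= hi)).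
  (* The witness is quantified before [ok q], so that choice yields an operator on all functions;
     off [ok] it takes the dummy value q. *)
  assert (HT0 : forall q, exists v, ok q -> ok v /\
            forall t, is_derive v t (Psi t (q t) - K * v t)).
  { intros q. destruct (excluded_middle_informative (ok q)) as [Hq | Hq];
      [| exists q; intros H; contradiction].
    destruct (linear_bounded_solution K (K * lo) (K * hi) (fun t => Psi t (q t)) HK)
      as [v Hv].
    - apply Hcont, Hq.
    - intros t. apply Hmap, Hq.
    - exists v. intros _. split; [split |]; intros t; destruct (Hv t) as [Dv Bv].
      + exact (is_derive_continuous _ _ _ Dv).
      + replace (K * lo / K) with lo in Bv by (field; lra).
        replace (K * hi / K) with hi in Bv by (field; lra). exact Bv.
      + exact Dv. }
  destruct (choice_fun _ _ _ HT0) as [T HT].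
  assert (Hgap : forall p q t, ok p -> ok q -> Rabs (p t - q t) <= hi - lo).
  { intros p q t [_ Hp] [_ Hq]. generalize (Hp t) (Hq t). intros. apply Rabs_le. lra. }
  assert (Hcontr : forall p q delta, ok p -> ok q ->
            (forall t, Rabs (p t - q t) <= delta) ->
            forall t, Rabs (T p t - T q t) <= theta * delta).
  { intros p q delta Hp Hq Hpq t.
    destruct (HT p Hp) as [Op Dp], (HT q Hq) as [Oq Dq].
    replace (theta * delta) with (theta * K * delta / K) by (field; lra).
    apply (bounded_solutions_close K (hi - lo) (theta * K * delta) (T p) (T q)
             (fun t => Psi t (p t)) (fun t => Psi t (q t)) HK Dp Dq).
    - intros x. apply Hgap; assumption.
    - intros x. eapply Rle_trans; [apply Hlip; [apply Hp | apply Hq] |].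
      apply Rmult_le_compat_l; [nra | apply Hpq]. }
  set (q := fix q n := match n with O => fun _ : R => lo | S n => T (q n) end).
  assert (Hok : forall n, ok (q n)).
  { induction n as [| n IH].
    - split; [intros t; apply continuous_const | intros t; simpl; lra].
    - apply (HT _ IH). }
  assert (Hcauchy : forall n p t, Rabs (q (n + p)%nat t - q n t) <= theta ^ n * (hi - lo)).
  { induction n as [| n IH]; intros p t.
    - rewrite Rmult_1_l. apply Hgap; apply Hok.
    - simpl. rewrite Rmult_assoc. apply Hcontr; [apply Hok .. | apply IH]. }
  assert (Hsmall : forall eps, 0 < eps -> exists n, theta ^ n * (hi - lo) < eps).
  { intros eps Heps.
    assert (Habs : Rabs theta < 1) by (rewrite Rabs_pos_eq; lra).
    destruct (pow_lt_1_zero theta Habs (eps / (hi - lo + 1))) as [N HN].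
    - apply Rdiv_lt_0_compat; lra.
    - exists N. specialize (HN N (le_n N)).
      assert (Hpw : 0 <= theta ^ N) by (apply pow_le; lra).
      rewrite Rabs_pos_eq in HN by exact Hpw.
      apply (Rmult_lt_compat_r (hi - lo + 1)) in HN; [| lra].
      replace (eps / (hi - lo + 1) * (hi - lo + 1)) with eps in HN by (field; lra).
      nra. }
  assert (Hlim : forall t, exists l, forall n, Rabs (q n t - l) <= theta ^ n * (hi - lo)).
  { intros t.
    assert (Hcr : Cauchy_crit (fun n => q n t)).
    { intros eps Heps. destruct (Hsmall (eps / 2)) as [N HN]; [lra |].
      exists N. intros n m Hn Hm. unfold Rdist.
      replace n with (N + (n - N))%nat by lia. replace m with (N + (m - N))%nat by lia.
      generalize (proj1 (Rabs_le_between _ _) (Hcauchy N (n - N)%nat t))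
        (proj1 (Rabs_le_between _ _) (Hcauchy N (m - N)%nat t)); intros A1 A2.
      apply Rabs_def1; lra. }
    destruct (Rcomplete.R_complete _ Hcr) as [l Hl]. exists l. intros n.
    apply le_epsilon. intros eps Heps.
    destruct (Hl eps Heps) as [N HN].
    specialize (HN (n + N)%nat ltac:(lia)). unfold Rdist in HN.
    apply Rabs_def2 in HN.
    generalize (proj1 (Rabs_le_between _ _) (Hcauchy n N t)); intros A1.
    apply Rabs_le. lra. }
  destruct (choice_fun _ _ _ Hlim) as [l Hl].
  assert (Okl : ok l).
  { split.
    - apply (uniform_limit_continuous q l (fun n => theta ^ n * (hi - lo))).
      + intros n. apply (Hok n).
      + intros n t. apply Hl.
      + exact Hsmall.
    - intros t. split; apply le_epsilon; intros eps Heps;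
        destruct (Hsmall eps Heps) as [n Hn];
        generalize (proj1 (Rabs_le_between _ _) (Hl t n)) (proj2 (Hok n) t); lra. }
  (* [T l] and [l] are both within a multiple of theta^n of the iterate [q (S n)]. They are
     identified pointwise only, hence the transport by [is_derive_ext] below. *)
  assert (Hfix : forall t, T l t = l t).
  { intros t. apply cond_eq. intros eps Heps.
    destruct (Hsmall (eps / 2)) as [n Hn]; [lra |].
    assert (H1 : Rabs (T (q n) t - T l t) <= theta * (theta ^ n * (hi - lo))).
    { apply Hcontr; [apply Hok | exact Okl | intros x; apply Hl]. }
    generalize (Hl t (S n)); intros H2.
    change (q (S n) t) with (T (q n) t) in H2. simpl in H2. rewrite Rmult_assoc in H2.
    assert (H3 : 0 <= theta ^ n * (hi - lo)) by (apply Rmult_le_pos; [apply pow_le |]; lra).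
    apply Rabs_le_between in H1, H2.
    apply Rabs_def1; nra. }
  destruct (HT l Okl) as [_ Dl].
  exists l. intros t. split; [| apply Okl].
  apply (is_derive_ext (T l)); [exact Hfix |].
  rewrite <- (Hfix t) at 2. apply Dl.
Qed.

(** * The slow orbit and the change of independent variable *)

Lemma intermediate_value (f : R -> R) (a b y : R) :
  a < b -> (forall x, a <= x <= b -> continuous f x) -> f a < y < f b ->
  exists x, a <= x <= b /\ f x = y.
Proof.
  intros Hab Hf [Ha Hb].
  destruct (IVT_interv (fun x => f x - y) a b) as [x [Hx Ex]].
  - intros x Hx. apply continuity_pt_minus; [| apply continuity_pt_const; intros ? ?; reflexivity].
    apply continuity_pt_filterlim, Hf, Hx.
  - exact Hab.
  - lra.
  - lra.
  - exists x. split; [exact Hx | lra].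
Qed.

Lemma antiderivative_on_interval (f : R -> R) (c d m : R) :
  c < m < d -> (forall t, c < t < d -> continuous f t) ->
  exists J, J m = 0 /\ forall t, c < t < d -> is_derive J t (f t).
Proof.
  intros Hm Hf. exists (fun t => RInt f m t). split; [exact (RInt_point m f) |].
  intros t Ht.
  apply (is_derive_RInt f (fun t => RInt f m t) m t); [| apply Hf, Ht].
  assert (Hd : 0 < Rmin (t - c) (d - t)) by (apply Rmin_pos; lra).
  exists (mkposreal _ Hd). intros y Hy. change (Rabs (y - t) < Rmin (t - c) (d - t)) in Hy.
  generalize (Rmin_l (t - c) (d - t)) (Rmin_r (t - c) (d - t)); intros M1 M2.
  apply Rabs_def2 in Hy.
  apply (RInt_correct f), ex_RInt_continuous. intros z Hz. apply Hf.
  unfold Rmin, Rmax in Hz. destruct (Rle_dec m y); lra.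
Qed.

(* [E] is at most linear at its zeros, so the travel time [int dy / E y]
   diverges at both ends of (c, d). *)
Lemma connecting_orbit (E dE : R -> R) (c d L : R) :
  c < d -> 0 < L ->
  (forall y, c <= y <= d -> is_derive E y (dE y)) ->
  (forall y, c <= y <= d -> Rabs (dE y) <= L) ->
  E c = 0 -> E d = 0 -> (forall y, c < y < d -> 0 < E y) ->
  exists rho : R -> R,
    (forall t, c < rho t < d /\ is_derive rho t (E (rho t))) /\
    (forall y, c < y < d -> exists t, rho t = y).
Proof.
  intros Hcd HL HE HdE Ec Ed Epos.
  assert (Hlinc : forall y, c < y < d -> E y <= L * (y - c)).
  { intros y Hy. destruct (mean_value E dE c y) as [xi [Hxi Exi]];
      [lra | intros; apply HE; lra |].
    assert (H := HdE xi ltac:(lra)). apply Rabs_le_between in H. nra. }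
  assert (Hlind : forall y, c < y < d -> E y <= L * (d - y)).
  { intros y Hy. destruct (mean_value E dE y d) as [xi [Hxi Exi]];
      [lra | intros; apply HE; lra |].
    assert (H := HdE xi ltac:(lra)). apply Rabs_le_between in H. nra. }
  assert (Hinv : forall y z, c < y < d -> 0 < z -> E y <= L * z -> / (L * z) <= / E y).
  { intros y z Hy Hz HEz. apply Rinv_le_contravar; [apply Epos, Hy | exact HEz]. }
  set (m := (c + d) / 2).
  assert (Hm : c < m < d) by (unfold m; lra).
  destruct (antiderivative_on_interval (fun y => / E y) c d m Hm) as [X [Xm HX]].
  { intros y Hy. apply (continuous_Rinv_comp E).
    - apply (is_derive_continuous _ _ (dE y)), HE. lra.
    - generalize (Epos y Hy). lra. }
  assert (Hhigh : forall x, exists s, m <= s < d /\ x < X s).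
  { intros x. set (k := Rabs x + 1).
    assert (Hk : 0 < k) by (generalize (Rabs_pos x); unfold k; lra).
    assert (He : exp (- (L * k)) < 1) by (rewrite <- exp_0; apply exp_increasing; nra).
    generalize (exp_pos (- (L * k))); intros He0.
    (* Since 1/E >= 1/(L (d - y)), the travel time from m to s is at least ln((d - m)/(d - s))/L;
       this s makes that bound equal to k, which exceeds x. *)
    exists (d - (d - m) * exp (- (L * k))).
    set (s := d - (d - m) * exp (- (L * k))).
    assert (Hs : m <= s < d) by (unfold s; nra).
    split; [exact Hs |].
    assert (Hmono : X m + ln (d - m) / L <= X s + ln (d - s) / L).
    { apply (nondecreasing_of_derive (fun y => X y + ln (d - y) / L)
               (fun y => / E y - / (L * (d - y)))); [lra | |].
      - intros y Hy. auto_derive.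
        + split; [exists (/ E y); apply HX; lra | lra].
        + replace (Derive (fun x => X x) y) with (/ E y)
            by (symmetry; apply is_derive_unique, HX; lra).
          assert (0 < E y) by (apply Epos; lra). field. lra.
      - intros y Hy.
        generalize (Hinv y (d - y) ltac:(lra) ltac:(lra) (Hlind y ltac:(lra))). lra. }
    replace (d - s) with ((d - m) * exp (- (L * k))) in Hmono by (unfold s; ring).
    rewrite ln_mult, ln_exp in Hmono; [| lra | exact He0].
    replace ((ln (d - m) + - (L * k)) / L) with (ln (d - m) / L - k) in Hmono by (field; lra).
    generalize (Rle_abs x). unfold k in Hmono. lra. }
  assert (Hlow : forall x, exists s, c < s <= m /\ X s < x).
  { intros x. set (k := Rabs x + 1).
    assert (Hk : 0 < k) by (generalize (Rabs_pos x); unfold k; lra).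
    assert (He : exp (- (L * k)) < 1) by (rewrite <- exp_0; apply exp_increasing; nra).
    generalize (exp_pos (- (L * k))); intros He0.
    exists (c + (m - c) * exp (- (L * k))).
    set (s := c + (m - c) * exp (- (L * k))).
    assert (Hs : c < s <= m) by (unfold s; nra).
    split; [exact Hs |].
    assert (Hmono : X s - ln (s - c) / L <= X m - ln (m - c) / L).
    { apply (nondecreasing_of_derive (fun y => X y - ln (y - c) / L)
               (fun y => / E y - / (L * (y - c)))); [lra | |].
      - intros y Hy. auto_derive.
        + split; [exists (/ E y); apply HX; lra | lra].
        + replace (Derive (fun x => X x) y) with (/ E y)
            by (symmetry; apply is_derive_unique, HX; lra).
          assert (0 < E y) by (apply Epos; lra). field. lra.
      - intros y Hy.
        generalize (Hinv y (y - c) ltac:(lra) ltac:(lra) (Hlinc y ltac:(lra))). lra. }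
    replace (s - c) with ((m - c) * exp (- (L * k))) in Hmono by (unfold s; ring).
    rewrite ln_mult, ln_exp in Hmono; [| lra | exact He0].
    replace ((ln (m - c) + - (L * k)) / L) with (ln (m - c) / L - k) in Hmono by (field; lra).
    generalize (Rle_abs (- x)). rewrite Rabs_Ropp. unfold k in Hmono. lra. }
  (* [X] is time as a function of position, with derivative 1/E, so its inverse solves rho' =
     E(rho). *)
  destruct (inverse_function (fun s => c < s < d) X (fun s => / E s)) as [rho [H1 H2]].
  - intros s Hs. apply (locally_interval _ s c d); simpl; tauto.
  - intros; lra.
  - exact HX.
  - intros s Hs. apply Rinv_0_lt_compat, Epos, Hs.
  - intros x. destruct (Hlow x) as [s1 [Hs1 Ex1]], (Hhigh x) as [s2 [Hs2 Ex2]].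
    assert (Hne : s1 <> s2) by (intros ->; lra).
    destruct (intermediate_value X s1 s2 x) as [s [Hs Es]].
    + lra.
    + intros y Hy. apply (is_derive_continuous _ _ (/ E y)), HX. lra.
    + lra.
    + exists s. split; [lra | exact Es].
  - exists rho. split.
    + intros t. destruct (H1 t) as [A1 [_ A2]]. split; [exact A1 |].
      rewrite Rinv_inv in A2. exact A2.
    + intros y Hy. exists (X y). apply H2, Hy.
Qed.

(** [theta] is t as a function of x when dx/dt = r. The uniform lower bound makes x run over the
    whole line in both directions, so the profile is defined for every x. *)
Lemma time_change (r : R -> R) (r0 : R) :
  0 < r0 -> (forall t, continuous r t) -> (forall t, r0 <= r t) ->
  exists theta : R -> R,
    (forall x, is_derive theta x (/ r (theta x))) /\
    (forall t, exists x, theta x = t).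
Proof.
  intros Hr0 Hc Hr.
  destruct (antiderivative r Hc) as [X HX].
  assert (Hgrow : forall s t, s <= t -> r0 * (t - s) <= X t - X s).
  { intros s t Hst.
    enough (X s - r0 * s <= X t - r0 * t) by lra.
    apply (nondecreasing_of_derive (fun t => X t - r0 * t) (fun t => r t - r0)); [exact Hst | |].
    - intros y _. auto_derive; [exists (r y); apply HX |].
      replace (Derive (fun x => X x) y) with (r y)
        by (symmetry; apply is_derive_unique, HX). ring.
    - intros y _. generalize (Hr y). lra. }
  destruct (inverse_function (fun _ => True) X r) as [theta [H1 H2]].
  - intros s _. apply filter_true.
  - intros; exact I.
  - intros; apply HX.
  - intros s _. generalize (Hr s). lra.
  - intros x.
    set (k := (Rabs (x - X 0) + 1) / r0).
    assert (Hk : 0 < k).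
    { apply Rdiv_lt_0_compat; [generalize (Rabs_pos (x - X 0)) |]; lra. }
    assert (Ek : r0 * k = Rabs (x - X 0) + 1) by (unfold k; field; lra).
    generalize (Hgrow 0 k ltac:(lra)) (Hgrow (- k) 0 ltac:(lra))
      (Rle_abs (x - X 0)) (Rle_abs (- (x - X 0))).
    rewrite Rabs_Ropp. intros A1 A2 A3 A4.
    destruct (intermediate_value X (- k) k x) as [s [Hs Es]].
    + lra.
    + intros y _. exact (is_derive_continuous _ _ _ (HX y)).
    + lra.
    + exists s. split; [exact I | exact Es].
  - exists theta. split.
    + intros x. apply H1.
    + intros t. exists (X t). apply H2, I.
Qed.

(** * The rate equation and the monotone profile *)

(** Near r = a the right-hand side is about a b - a^2 (r - a), so b displaces r by about beta/a; the
    radius 2 beta/a leaves a factor of two for the nonlinear terms, and beta <= a^2/20 keeps it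
    below a/10. *)
Lemma slaved_rate (a beta : R) (b : R -> R) :
  0 < a -> 0 <= beta <= a ^ 2 / 20 ->
  (forall t, continuous b t) -> (forall t, Rabs (b t) <= beta) ->
  exists r : R -> R, forall t,
    is_derive r t (r t * (b t + a * r t - (r t) ^ 2)) /\
    Rabs (r t - a) <= 2 * beta / a.
Proof.
  intros Ha Hbeta Hc Hb.
  set (eta := 2 * beta / a).
  assert (Eeta : eta * a = 2 * beta) by (unfold eta; field; lra).
  assert (Heta : 0 <= eta <= a / 10) by nra.
  (* Taking K twice the attraction rate keeps 2 a^2 - q^2 nonnegative up to q = a + eta, which the
     invariance of the interval uses. *)
  destruct (entire_bounded_solution (2 * a ^ 2) (19 / 20) (a - eta) (a + eta)
              (fun t q => 2 * a ^ 2 * q + q * (b t + a * q - q ^ 2))) as [r Hr].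
  - nra.
  - lra.
  - lra.
  - intros q Hq t.
    apply (continuous_plus (fun t => 2 * a ^ 2 * q t) (fun t => q t * (b t + a * q t - q t ^ 2))).
    + apply (continuous_mult (fun _ => 2 * a ^ 2) q); [apply continuous_const | apply Hq].
    + apply (continuous_mult q (fun t => b t + a * q t - q t ^ 2)); [apply Hq |].
      apply (continuous_minus (fun t => b t + a * q t) (fun t => q t ^ 2)).
      * apply (continuous_plus b (fun t => a * q t)); [apply Hc |].
        apply (continuous_mult (fun _ => a) q); [apply continuous_const | apply Hq].
      * simpl. apply (continuous_mult q (fun t => q t * 1)); [apply Hq |].
        apply (continuous_mult q (fun _ => 1)); [apply Hq | apply continuous_const].
  - intros t q Hq. generalize (Hb t); intros Hbt. apply Rabs_le_between in Hbt.
    assert (Hq2 : 0 <= 2 * a ^ 2 - q ^ 2) by nra.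
    assert (Hqe : beta <= q * eta) by nra.
    (* The distance from [Psi] up to K (a + eta) is the sum of the products in [H1] and [H3]; the
       distance down to K (a - eta) is the sum of those in [H2] and [H4]. *)
    assert (H1 : 0 <= (2 * a ^ 2 - q ^ 2) * (a + eta - q)) by (apply Rmult_le_pos; lra).
    assert (H2 : 0 <= (2 * a ^ 2 - q ^ 2) * (q - a + eta)) by (apply Rmult_le_pos; lra).
    assert (H3 : 0 <= q * (q * eta - b t)) by (apply Rmult_le_pos; lra).
    assert (H4 : 0 <= q * (q * eta + b t)) by (apply Rmult_le_pos; lra).
    split; nra.
  - intros t p q Hp Hq. generalize (Hb t); intros Hbt. apply Rabs_le_between in Hbt.
    replace (2 * a ^ 2 * p + p * (b t + a * p - p ^ 2) -
             (2 * a ^ 2 * q + q * (b t + a * q - q ^ 2)))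
      with ((2 * a ^ 2 + b t + a * (p + q) - (p ^ 2 + p * q + q ^ 2)) * (p - q)) by ring.
    rewrite Rabs_mult. apply Rmult_le_compat_r; [apply Rabs_pos |].
    (* At p = q = a and b = 0 this factor is a^2, half of K; the ratio 19/20 leaves ample room on
       the interval. *)
    apply Rabs_le. split; nra.
  - exists r. intros t. destruct (Hr t) as [D B]. split.
    + replace (r t * (b t + a * r t - r t ^ 2))
        with (2 * a ^ 2 * r t + r t * (b t + a * r t - r t ^ 2) - 2 * a ^ 2 * r t) by ring.
      exact D.
    + apply Rabs_le. fold eta. lra.
Qed.

(** Of the two bounds by beta, the one on [dF] controls the slow orbit and the second derivative,
    the other is the bound on b in the rate equation. That u is onto (c, d) is recorded because,
    with monotonicity, it determines the limits at infinity. *)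
Lemma monotone_profile (F dF : R -> R) (a c d beta : R) :
  0 < a -> 0 < c < d -> 0 < beta <= a ^ 2 / 20 ->
  (forall y, c <= y <= d -> is_derive F y (dF y)) ->
  (forall y, c <= y <= d -> continuous dF y) ->
  F c = 0 -> F d = 0 -> (forall y, c < y < d -> F y < 0) ->
  (forall y, c <= y <= d -> Rabs (dF y) <= beta) ->
  (forall y, c <= y <= d -> Rabs (dF y - F y / (2 * y)) <= beta) ->
  exists u v : R -> R,
    (forall x, c < u x < d /\ v x < 0 /\ is_derive u x (v x) /\
       is_derive v x (F (u x) - a * v x + (v x) ^ 2 / (2 * u x)) /\
       Rabs (v x) <= 2 / a * Rabs (F (u x)) /\
       Rabs (F (u x) - a * v x + (v x) ^ 2 / (2 * u x)) <= 5 * beta / a * Rabs (v x)) /\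
    (forall y, c < y < d -> exists x, u x = y).
Proof.
  intros Ha Hcd Hbeta HF HcF Fc Fd Fneg Hd1 Hd2.
  (* The orbit lemma wants a positive field, so it is applied to -F and run backwards: [rho (- t)]
     solves the equation with field F and decreases from d to c. *)
  destruct (connecting_orbit (fun y => - F y) (fun y => - dF y) c d beta) as [rho [Hrho Srho]].
  { lra. } { lra. }
  { intros y Hy. apply (is_derive_opp (V := R_NormedModule)), HF, Hy. }
  { intros y Hy. rewrite Rabs_Ropp. apply Hd1, Hy. }
  { rewrite Fc. ring. } { rewrite Fd. ring. }
  { intros y Hy. generalize (Fneg y Hy). lra. }
  assert (Crho : forall t, continuous (fun t => rho (- t)) t).
  { intros t. apply (continuous_comp Ropp rho).
    - apply (continuous_opp (V := R_NormedModule) (fun t => t)), continuous_id.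
    - exact (is_derive_continuous _ _ _ (proj2 (Hrho (- t)))). }
  set (b := fun t => dF (rho (- t)) - F (rho (- t)) / (2 * rho (- t))).
  destruct (slaved_rate a beta b) as [r Hr].
  { exact Ha. } { lra. }
  { intros t. destruct (Hrho (- t)) as [Ht _].
    apply (continuous_comp (fun t => rho (- t)) (fun y => dF y - F y / (2 * y))); [apply Crho |].
    apply (continuous_minus dF (fun y => F y / (2 * y))); [apply HcF; lra |].
    apply (continuous_mult F (fun y => / (2 * y))).
    - apply (is_derive_continuous _ _ (dF (rho (- t)))), HF. lra.
    - apply (continuous_Rinv_comp (fun y => 2 * y)); [| lra].
      apply (continuous_mult (fun _ => 2) (fun y => y)); [apply continuous_const | apply continuous_id]. }
  { intros t. apply Hd2. generalize (proj1 (Hrho (- t))). lra. }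
  assert (Heta : 2 * beta / a * a = 2 * beta) by (field; lra).
  assert (Heta0 : 0 <= 2 * beta / a <= a / 10) by nra.
  assert (Br : forall t, 9 / 10 * a <= r t <= 11 / 10 * a).
  { intros t. generalize (proj2 (Hr t)); intros H. apply Rabs_le_between in H. lra. }
  destruct (time_change r (9 / 10 * a)) as [theta [Htheta Stheta]].
  { lra. }
  { intros t. exact (is_derive_continuous _ _ _ (proj1 (Hr t))). }
  { intros t. apply Br. }
  set (u := fun x => rho (- theta x)).
  assert (Du : forall x, is_derive u x (F (u x) / r (theta x))).
  { intros x. generalize (Br (theta x)); intros Bx. unfold u. auto_derive.
    - split; [exists (- F (rho (- theta x))); apply Hrho |].
      split; [exists (/ r (theta x)); apply Htheta | exact I].
    - replace (Derive (fun x => rho x) (- theta x)) with (- F (rho (- theta x)))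
        by (symmetry; apply is_derive_unique, Hrho).
      replace (Derive (fun x => theta x) x) with (/ r (theta x))
        by (symmetry; apply is_derive_unique, Htheta). field. lra. }
  assert (Bu : forall x, c < u x < d) by (intros x; apply Hrho).
  set (v := fun x => F (u x) / r (theta x)).
  (* [r' / r = b + a r - r^2] makes the second-order equation collapse to this. *)
  assert (Ev : forall x, F (u x) - a * v x + v x ^ 2 / (2 * u x) =
            v x * ((dF (u x) - (b (theta x) + a * r (theta x) - r (theta x) ^ 2)) / r (theta x))).
  { intros x. generalize (Br (theta x)) (Bu x); intros Bx Ux. unfold v, b.
    change (rho (- theta x)) with (u x). field. lra. }
  exists u, v. split.
  - intros x. generalize (Br (theta x)) (Bu x); intros Bx Ux.
    assert (Bx' : 0 < / r (theta x) <= 2 / a).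
    { split; [apply Rinv_0_lt_compat; lra |].
      apply (Rmult_le_reg_l (r (theta x) * a)); [nra |].
      replace (r (theta x) * a * / r (theta x)) with a by (field; lra).
      replace (r (theta x) * a * (2 / a)) with (2 * r (theta x)) by (field; lra). lra. }
    split; [exact Ux |]. split; [| split; [| split; [| split]]].
    + unfold v, Rdiv. generalize (Fneg _ Ux). nra.
    + apply Du.
    + rewrite Ev. unfold v. auto_derive.
      * split; [exists (dF (u x)); apply HF; lra |].
        split; [exists (F (u x) / r (theta x)); apply Du |].
        split; [eexists; apply Hr |].
        split; [exists (/ r (theta x)); apply Htheta |].
        split; [lra | exact I].
      * replace (Derive (fun x => F x) (u x)) with (dF (u x))
          by (symmetry; apply is_derive_unique, HF; lra).
        replace (Derive (fun x => u x) x) with (F (u x) / r (theta x))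
          by (symmetry; apply is_derive_unique, Du).
        replace (Derive (fun x => theta x) x) with (/ r (theta x))
          by (symmetry; apply is_derive_unique, Htheta).
        replace (Derive (fun x => r x) (theta x)) with
          (r (theta x) * (b (theta x) + a * r (theta x) - r (theta x) ^ 2))
          by (symmetry; apply is_derive_unique, Hr).
        field. lra.
    + unfold v, Rdiv. rewrite Rabs_mult, Rmult_comm, (Rabs_pos_eq (/ _)) by lra.
      apply Rmult_le_compat_r; [apply Rabs_pos | unfold Rdiv in Bx'; lra].
    + rewrite Ev, Rabs_mult, Rmult_comm. apply Rmult_le_compat_r; [apply Rabs_pos |].
      unfold Rdiv at 1. rewrite Rabs_mult, (Rabs_pos_eq (/ _)) by lra.
      (* The terms are at most beta, beta and r |a - r| <= (11/10) a (2 beta/a), in total 4.2 beta.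
         Dividing 9/2 beta by r >= 9a/10 gives exactly 5 beta/a. *)
      assert (Hnum : Rabs (dF (u x) - (b (theta x) + a * r (theta x) - r (theta x) ^ 2))
                     <= 9 / 2 * beta).
      { generalize (Hd1 (u x) ltac:(lra)) (Hd2 (u x) ltac:(lra)) (proj2 (Hr (theta x))).
        change (dF (u x) - F (u x) / (2 * u x)) with (b (theta x)).
        intros A1 A2 A3. apply Rabs_le_between in A1, A2, A3.
        apply Rabs_le. split; nra. }
      apply (Rmult_le_reg_r (r (theta x))); [lra |].
      rewrite Rmult_assoc, Rinv_l, Rmult_1_r by lra.
      apply (Rle_trans _ _ _ Hnum).
      apply (Rmult_le_reg_r a); [exact Ha |].
      replace (5 * beta / a * r (theta x) * a) with (5 * beta * r (theta x)) by (field; lra).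
      nra.
  - intros y Hy. destruct (Srho y Hy) as [t Et]. destruct (Stheta (- t)) as [x Ex].
    exists x. unfold u. rewrite Ex, Ropp_involutive. exact Et.
Qed.

(** * The profile nonlinearity *)

(** One formula covers the logarithm and the powers, so the case split on [gamma] ends here. *)
Lemma enthalpy_derive (gamma y : R) :
  0 < y -> is_derive (enthalpy gamma) y (gamma * Rpower y (gamma - 2)).
Proof.
  intros Hy. unfold enthalpy. destruct (Req_EM_T gamma 1) as [-> | Hg].
  - replace (1 * Rpower y (1 - 2)) with (/ y).
    + apply is_derive_ln, Hy.
    + replace (1 - 2) with (- (1)) by ring. rewrite Rpower_Ropp, Rpower_1 by exact Hy. ring.
  - replace (gamma * Rpower y (gamma - 2)) with
      (gamma / (gamma - 1) * ((gamma - 1) * Rpower y (gamma - 1 - 1))).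
    + apply is_derive_scal, is_derive_Reals, derivable_pt_lim_power, Hy.
    + replace (gamma - 1 - 1) with (gamma - 2) by ring. field. lra.
Qed.

(** The end states enter through symmetric expressions and divided differences, so a single analysis
    with ordered end states c < d serves both signs of s. *)
Lemma profile_f_sym (gamma Rm Rp r : R) :
  Rm <> Rp -> profile_f gamma Rm Rp r = profile_f gamma Rp Rm r.
Proof.
  intros Hne. unfold profile_f. rewrite (Rplus_comm Rm Rp). f_equal.
  replace ((Rm * Rp) ^ 2) with ((Rp * Rm) ^ 2) by ring.
  replace ((enthalpy gamma Rm - enthalpy gamma Rp) / (Rm - Rp))
    with ((enthalpy gamma Rp - enthalpy gamma Rm) / (Rp - Rm)) by (field; lra).
  replace ((Rm ^ 2 * enthalpy gamma Rm - Rp ^ 2 * enthalpy gamma Rp) / (Rm - Rp))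
    with ((Rp ^ 2 * enthalpy gamma Rp - Rm ^ 2 * enthalpy gamma Rm) / (Rp - Rm)) by (field; lra).
  reflexivity.
Qed.

Lemma Rpower_lipschitz (p M x y : R) :
  1 <= p -> 0 < x < y -> y <= M ->
  0 < Rpower y p - Rpower x p <= p * Rpower M (p - 1) * (y - x).
Proof.
  intros Hp Hxy HyM.
  destruct (mean_value (fun z => Rpower z p) (fun z => p * Rpower z (p - 1)) x y)
    as [xi [Hxi Exi]].
  - lra.
  - intros z Hz. apply is_derive_Reals, derivable_pt_lim_power. lra.
  - rewrite Exi.
    assert (H0 : 0 < Rpower xi (p - 1)) by apply exp_pos.
    assert (Hle : Rpower xi (p - 1) <= Rpower M (p - 1)) by (apply Rle_Rpower_l; lra).
    split; [apply Rmult_lt_0_compat; nra |].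
    apply Rmult_le_compat_r; [lra |]. apply Rmult_le_compat_l; lra.
Qed.

(* [g] is the bracket in [profile_f] divided by [Rp + Rm]; writing its derivative through
   the zero [z] provided by Rolle makes both its sign and its size evident. *)
Lemma profile_f_structure (gamma c d : R) :
  1 <= gamma -> 0 < c < d ->
  exists g z, c < z < d /\ g c = 0 /\ g d = 0 /\
    (forall y, 0 < y -> profile_f gamma c d y = y * g y) /\
    (forall y, 0 < y ->
       is_derive g y (gamma * (Rpower y (gamma + 1) - Rpower z (gamma + 1)) / y ^ 3)).
Proof.
  intros Hg Hcd.
  set (h := enthalpy gamma).
  set (A := (d * c) ^ 2 * ((h d - h c) / (d - c)) / (d + c)).
  set (B := (d ^ 2 * h d - c ^ 2 * h c) / (d - c) / (d + c)).
  set (g := fun y => A / y ^ 2 + h y - B).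
  assert (Hpow : forall y, 0 < y -> Rpower y (gamma - 2) * y ^ 3 = Rpower y (gamma + 1)).
  { intros y Hy. rewrite <- (Rpower_pow 3 y Hy), <- Rpower_plus. f_equal. simpl. ring. }
  assert (Dg : forall y, 0 < y -> is_derive g y ((gamma * Rpower y (gamma + 1) - 2 * A) / y ^ 3)).
  { intros y Hy. unfold g. auto_derive.
    - split; [nra | split; [eexists; apply enthalpy_derive, Hy | exact I]].
    - replace (Derive (fun x => h x) y) with (gamma * Rpower y (gamma - 2))
        by (symmetry; apply is_derive_unique, enthalpy_derive, Hy).
      rewrite <- (Hpow y Hy). field. lra. }
  assert (gc : g c = 0) by (unfold g, A, B; field; lra).
  assert (gd : g d = 0) by (unfold g, A, B; field; lra).
  destruct (mean_value g (fun y => (gamma * Rpower y (gamma + 1) - 2 * A) / y ^ 3) c d)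
    as [z [Hz Ez]].
  { lra. } { intros y Hy. apply Dg. lra. }
  assert (Az : 2 * A = gamma * Rpower z (gamma + 1)).
  { rewrite gc, gd in Ez.
    assert (Hz3 : 0 < z ^ 3) by (apply pow_lt; lra).
    assert (E0 : (gamma * Rpower z (gamma + 1) - 2 * A) / z ^ 3 = 0) by nra.
    apply (f_equal (fun t => t * z ^ 3)) in E0.
    replace ((gamma * Rpower z (gamma + 1) - 2 * A) / z ^ 3 * z ^ 3)
      with (gamma * Rpower z (gamma + 1) - 2 * A) in E0 by (field; lra). lra. }
  exists g, z. split; [exact Hz | split; [exact gc | split; [exact gd | split]]].
  - intros y Hy. unfold profile_f. fold h. unfold g, A, B. field. lra.
  - intros y Hy. replace (gamma * (Rpower y (gamma + 1) - Rpower z (gamma + 1)))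
      with (gamma * Rpower y (gamma + 1) - 2 * A) by (rewrite Az; ring).
    apply Dg, Hy.
Qed.

Lemma profile_f_zeros (gamma c d : R) :
  0 < c < d -> profile_f gamma c d c = 0 /\ profile_f gamma c d d = 0.
Proof. intros H. unfold profile_f. split; field; lra. Qed.

(** * Weak profiles with uniform constants *)

(** [r0] stands for the fixed state R^-, which is the larger end state for s > 0 and the smaller one
    for s < 0; eps0 <= r0/2 keeps the other one in [r0/2, 2 r0] in either case. The last two bounds
    force v to 0 as u tends to an end state. *)
Lemma weak_profile (gamma k a r0 : R) :
  1 <= gamma -> 0 < k -> 0 < a -> 0 < r0 ->
  exists eps0 C, 0 < eps0 <= r0 / 2 /\ 0 < C /\
  forall c d, r0 / 2 <= c -> c < d -> d <= 2 * r0 -> d - c < eps0 ->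
  exists u v : R -> R,
    (forall y, c < y < d -> exists x, u x = y) /\
    forall x, let w := 2 / k ^ 2 * profile_f gamma c d (u x) - a * v x
                       + (v x) ^ 2 / (2 * u x) in
      c < u x < d /\ v x < 0 /\ is_derive u x (v x) /\ is_derive v x w /\
      Rabs (v x) <= C * (d - c) ^ 2 /\ Rabs w <= C * (d - c) * Rabs (v x) /\
      Rabs (v x) <= C * Rabs (u x - c) /\ Rabs (v x) <= C * Rabs (u x - d).
Proof.
  intros Hgamma Hk Ha Hr0.
  (* The derivative of gamma y^(gamma+1) at the largest admissible y, over the smallest admissible
     y^3; it yields |g'| <= D eps. *)
  set (D := gamma * ((gamma + 1) * Rpower (2 * r0) gamma) / (r0 / 2) ^ 3).
  assert (Hr3 : 0 < (r0 / 2) ^ 3) by (apply pow_lt; lra).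
  assert (HD : 0 < D).
  { apply Rdiv_lt_0_compat; [| exact Hr3].
    apply Rmult_lt_0_compat; [lra |]. apply Rmult_lt_0_compat; [lra | apply exp_pos]. }
  set (la := 2 / k ^ 2).
  assert (Hla : 0 < la) by (apply Rdiv_lt_0_compat; [lra | apply pow_lt, Hk]).
  (* From F = la y g: |F'| <= la (|g| + y |g'|) <= la (r0 D eps + 2 r0 D eps) = Q eps. *)
  set (Q := 3 * la * r0 * D).
  assert (HQ : 0 < Q) by (unfold Q; apply Rmult_lt_0_compat; nra).
  (* 5 Q/a is the constant 5 beta/a for beta = Q eps, with eps split off; 1 + r0 covers the bounds
     in which eps is estimated by r0. *)
  set (C := 5 * Q / a * (1 + r0)).
  assert (HC5 : 0 < 5 * Q / a) by (apply Rdiv_lt_0_compat; lra).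
  assert (HC : 5 * Q / a <= C /\ 5 * Q / a * r0 <= C) by (unfold C; split; nra).
  (* The second entry ensures Q eps <= a^2/20, the smallness that the rate equation requires. *)
  exists (Rmin (r0 / 2) (a ^ 2 / (20 * Q))), C.
  assert (He : 0 < a ^ 2 / (20 * Q)) by (apply Rdiv_lt_0_compat; [apply pow_lt |]; lra).
  split; [split; [apply Rmin_pos; lra | apply Rmin_l] | split; [lra |]].
  intros c d Hc Hcd Hd Heps.
  generalize (Rmin_l (r0 / 2) (a ^ 2 / (20 * Q))) (Rmin_r (r0 / 2) (a ^ 2 / (20 * Q))).
  intros M1 M2.
  set (eps := d - c) in *.
  assert (HQe : Q * eps <= a ^ 2 / 20).
  { replace (a ^ 2 / 20) with (Q * (a ^ 2 / (20 * Q))) by (field; lra).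
    apply Rmult_le_compat_l; lra. }
  assert (Heps0 : 0 < eps <= r0) by (unfold eps in *; lra).
  destruct (profile_f_structure gamma c d Hgamma) as [g [z [Hz [gc [gd [Hf Dg]]]]]]; [lra |].
  set (g1 := fun y => gamma * (Rpower y (gamma + 1) - Rpower z (gamma + 1)) / y ^ 3) in *.
  assert (Hy3 : forall y, c <= y -> 0 < / y ^ 3 <= / (r0 / 2) ^ 3).
  { intros y Hy. split; [apply Rinv_0_lt_compat, pow_lt; lra |].
    apply Rinv_le_contravar; [exact Hr3 | apply pow_incr; lra]. }
  assert (Hlip : forall x y, c <= x -> x < y -> y <= d ->
            0 < gamma * (Rpower y (gamma + 1) - Rpower x (gamma + 1))
              <= gamma * ((gamma + 1) * Rpower (2 * r0) gamma) * eps).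
  { intros x y Hx Hxy Hy.
    destruct (Rpower_lipschitz (gamma + 1) (2 * r0) x y) as [L1 L2]; [lra .. |].
    replace (gamma + 1 - 1) with gamma in L2 by ring.
    split; [apply Rmult_lt_0_compat; lra |].
    rewrite (Rmult_assoc gamma). apply Rmult_le_compat_l; [lra |].
    apply (Rle_trans _ _ _ L2). apply Rmult_le_compat_l; [| unfold eps; lra].
    apply Rmult_le_pos; [lra | left; apply exp_pos]. }
  assert (Hscale : forall t y, c <= y ->
            0 < t <= gamma * ((gamma + 1) * Rpower (2 * r0) gamma) * eps ->
            0 < t / y ^ 3 <= D * eps).
  { intros t y Hy Ht. generalize (Hy3 y Hy); intros Hy'.
    split; [apply Rmult_lt_0_compat; lra |].
    replace (D * eps) with (gamma * ((gamma + 1) * Rpower (2 * r0) gamma) * eps * / (r0 / 2) ^ 3)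
      by (unfold D; field; lra).
    unfold Rdiv. apply Rmult_le_compat; lra. }
  assert (Hright : forall y, z < y <= d -> 0 < g1 y <= D * eps).
  { intros y Hy. apply Hscale; [lra |]. apply Hlip; lra. }
  assert (Hleft : forall y, c <= y < z -> 0 < - g1 y <= D * eps).
  { intros y Hy.
    replace (- g1 y) with
      (gamma * (Rpower z (gamma + 1) - Rpower y (gamma + 1)) / y ^ 3)
      by (unfold g1; field; lra).
    apply Hscale; [lra |]. apply Hlip; lra. }
  assert (HDe : 0 < D * eps) by (apply Rmult_lt_0_compat; lra).
  assert (Bg1 : forall y, c <= y <= d -> Rabs (g1 y) <= D * eps).
  { intros y Hy. apply Rabs_le. destruct (Rtotal_order y z) as [H | [H | H]].
    - generalize (Hleft y ltac:(lra)). lra.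
    - subst y. replace (g1 z) with 0 by (unfold g1; field; lra). lra.
    - generalize (Hright y ltac:(lra)). lra. }
  (* Integrating g' from the zero at c gains the second power of eps, which becomes the bound on
     R'. *)
  assert (Bg : forall y, c <= y <= d -> Rabs (g y) <= D * eps * eps).
  { intros y Hy. destruct (proj1 Hy) as [Hlt | <-];
      [| rewrite gc, Rabs_R0; apply Rmult_le_pos; lra].
    destruct (mean_value g g1 c y Hlt) as [xi [Hxi Exi]]; [intros; apply Dg; lra |].
    rewrite gc, Rminus_0_r in Exi. rewrite Exi, Rabs_mult.
    apply Rmult_le_compat; [apply Rabs_pos .. | apply Bg1; lra |].
    rewrite Rabs_pos_eq; unfold eps; lra. }
  (* g falls from 0 on the left of z and rises back to 0 on the right. *)
  assert (gneg : forall y, c < y < d -> g y < 0).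
  { intros y Hy. destruct (Rle_lt_dec y z) as [H | H].
    - destruct (mean_value g g1 c y) as [xi [Hxi Exi]]; [lra | intros; apply Dg; lra |].
      generalize (Hleft xi ltac:(lra)). rewrite gc in Exi. nra.
    - destruct (mean_value g g1 y d) as [xi [Hxi Exi]]; [lra | intros; apply Dg; lra |].
      generalize (Hright xi ltac:(lra)). rewrite gd in Exi. nra. }
  set (F := fun y => la * (y * g y)).
  set (dF := fun y => la * (g y + y * g1 y)).
  assert (Bg' : forall y, c <= y <= d -> Rabs (g y) <= D * eps * r0).
  { intros y Hy. apply (Rle_trans _ _ _ (Bg y Hy)). apply Rmult_le_compat_l; lra. }
  assert (Bdyg : forall y, c <= y <= d -> Rabs (y * g1 y) <= 2 * r0 * (D * eps)).
  { intros y Hy. rewrite Rabs_mult.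
    apply Rmult_le_compat; [apply Rabs_pos .. | rewrite Rabs_pos_eq; lra | apply Bg1, Hy]. }
  assert (HF : forall y, c <= y <= d -> is_derive F y (dF y)).
  { intros y Hy. unfold F. auto_derive.
    - exists (g1 y). apply Dg. lra.
    - replace (Derive (fun x => g x) y) with (g1 y)
        by (symmetry; apply is_derive_unique, Dg; lra). unfold dF. ring. }
  assert (BdF : forall y, c <= y <= d -> Rabs (dF y) <= Q * eps).
  { intros y Hy. unfold dF. rewrite Rabs_mult, (Rabs_pos_eq la) by lra.
    replace (Q * eps) with (la * (D * eps * r0 + 2 * r0 * (D * eps))) by (unfold Q; ring).
    apply Rmult_le_compat_l; [lra |].
    eapply Rle_trans; [apply Rabs_triang |]. apply Rplus_le_compat; auto. }
  assert (Fc : F c = 0) by (unfold F; rewrite gc; ring).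
  assert (Fd : F d = 0) by (unfold F; rewrite gd; ring).
  destruct (monotone_profile F dF a c d (Q * eps)) as [u [v [Huv Hsurj]]].
  { exact Ha. } { lra. }
  { split; [apply Rmult_lt_0_compat; lra | exact HQe]. }
  { exact HF. }
  { intros y Hy.
    apply (continuous_mult (fun _ => la) (fun y => g y + y * g1 y)); [apply continuous_const |].
    apply (continuous_plus g (fun y => y * g1 y)).
    - apply (is_derive_continuous g y (g1 y)), Dg. lra.
    - apply (continuous_mult (fun y => y) g1); [apply continuous_id |].
      unfold g1.
      apply (continuous_mult (fun y => gamma * (Rpower y (gamma + 1) - Rpower z (gamma + 1)))
               (fun y => / y ^ 3)).
      + apply (continuous_mult (fun _ => gamma)
                 (fun y => Rpower y (gamma + 1) - Rpower z (gamma + 1)));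
          [apply continuous_const |].
        apply (continuous_minus (fun y => Rpower y (gamma + 1)) (fun _ => Rpower z (gamma + 1)));
          [| apply continuous_const].
        apply (is_derive_continuous (fun y => Rpower y (gamma + 1)) y
                 ((gamma + 1) * Rpower y (gamma + 1 - 1))).
        apply is_derive_Reals, derivable_pt_lim_power. lra.
      + apply (continuous_Rinv_comp (fun y => y ^ 3) y).
        * apply (ex_derive_continuous (V := R_NormedModule)). auto_derive. exact I.
        * apply pow_nonzero. lra. }
  { exact Fc. } { exact Fd. }
  { intros y Hy. unfold F. generalize (gneg y Hy); intros Hg.
    assert (0 < y * (- g y)) by (apply Rmult_lt_0_compat; lra). nra. }
  { exact BdF. }
  { intros y Hy. replace (dF y - F y / (2 * y)) with (la * (g y / 2 + y * g1 y))
      by (unfold F, dF; field; lra).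
    rewrite Rabs_mult, (Rabs_pos_eq la) by lra.
    replace (Q * eps) with (la * (D * eps * r0 + 2 * r0 * (D * eps))) by (unfold Q; ring).
    apply Rmult_le_compat_l; [lra |].
    eapply Rle_trans; [apply Rabs_triang |]. apply Rplus_le_compat; [| auto].
    unfold Rdiv. rewrite Rabs_mult, (Rabs_pos_eq (/ 2)) by lra.
    generalize (Bg' y Hy) (Rabs_pos (g y)). lra. }
  (* Used with one point at an end state, where F vanishes, so that |F(u)| is controlled by the
     distance of u to that state. *)
  assert (BFx : forall x y, c <= x -> x < y -> y <= d ->
            Rabs (F y - F x) <= Q * eps * (y - x)).
  { intros x y Hx Hxy Hy.
    destruct (mean_value F dF x y Hxy) as [xi [Hxi Exi]]; [intros; apply HF; lra |].
    rewrite Exi, Rabs_mult, (Rabs_pos_eq (y - x)) by lra.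
    apply Rmult_le_compat_r; [lra | apply BdF; lra]. }
  exists u, v. split; [exact Hsurj |]. intros x w.
  destruct (Huv x) as [Hu [Hv [D1 [D2 [B1 B2]]]]].
  assert (Ew : F (u x) - a * v x + v x ^ 2 / (2 * u x) = w).
  { unfold w, F. rewrite Hf by lra. reflexivity. }
  rewrite Ew in D2, B2.
  assert (H2a : 0 < 2 / a) by (apply Rdiv_lt_0_compat; lra).
  assert (E5 : 2 / a * (Q * eps) <= C).
  { replace (2 / a * (Q * eps)) with (2 / 5 * (5 * Q / a) * eps) by (field; lra). nra. }
  split; [exact Hu | split; [exact Hv | split; [exact D1 | split; [exact D2 |]]]].
  split; [| split; [| split]].
  - apply (Rle_trans _ _ _ B1).
    assert (BF : Rabs (F (u x)) <= la * (2 * r0 * (D * eps * eps))).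
    { unfold F. rewrite !Rabs_mult, (Rabs_pos_eq la), (Rabs_pos_eq (u x)) by lra.
      apply Rmult_le_compat_l; [lra |].
      apply Rmult_le_compat; [lra | apply Rabs_pos | lra | apply Bg; lra]. }
    apply (Rle_trans _ (2 / a * (la * (2 * r0 * (D * eps * eps))))).
    + apply Rmult_le_compat_l; lra.
    + replace (2 / a * (la * (2 * r0 * (D * eps * eps)))) with (4 / 15 * (5 * Q / a) * eps ^ 2)
        by (unfold Q; field; lra).
      apply Rmult_le_compat_r; [apply pow2_ge_0 | lra].
  - apply (Rle_trans _ _ _ B2). apply Rmult_le_compat_r; [apply Rabs_pos |].
    replace (5 * (Q * eps) / a) with (5 * Q / a * eps) by (field; lra).
    apply Rmult_le_compat_r; lra.
  - apply (Rle_trans _ _ _ B1).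
    generalize (BFx c (u x) ltac:(lra) ltac:(lra) ltac:(lra)).
    rewrite Fc, Rminus_0_r, (Rabs_pos_eq (u x - c)) by lra. intros BF.
    apply (Rle_trans _ (2 / a * (Q * eps * (u x - c)))); [apply Rmult_le_compat_l; lra |].
    rewrite <- Rmult_assoc. apply Rmult_le_compat_r; lra.
  - apply (Rle_trans _ _ _ B1).
    generalize (BFx (u x) d ltac:(lra) ltac:(lra) ltac:(lra)).
    rewrite Fd, Rminus_0_l, Rabs_Ropp, (Rabs_minus_sym (u x)), (Rabs_pos_eq (d - u x)) by lra.
    intros BF.
    apply (Rle_trans _ (2 / a * (Q * eps * (d - u x)))); [apply Rmult_le_compat_l; lra |].
    rewrite <- Rmult_assoc. apply Rmult_le_compat_r; lra.
Qed.

(** * Limits at infinity, reflection, and assembly of the trajectories *)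

(** Once u attains a value near an endpoint, monotonicity keeps it at least as near from there on.
    The minimum with (d - c)/2 keeps the value to be attained inside (c, d). *)
Lemma decreasing_onto_limits (u : R -> R) (c d : R) :
  c < d -> (forall x y, x < y -> u y < u x) -> (forall x, c < u x < d) ->
  (forall y, c < y < d -> exists x, u x = y) ->
  is_lim u m_infty d /\ is_lim u p_infty c.
Proof.
  intros Hcd Hdec Hu Hsurj.
  split; apply is_lim_spec; intros eps; generalize (cond_pos eps); intros Heps;
    assert (Hm : 0 < Rmin eps ((d - c) / 2)) by (apply Rmin_pos; lra);
    generalize (Rmin_l eps ((d - c) / 2)) (Rmin_r eps ((d - c) / 2)); intros M1 M2.
  - destruct (Hsurj (d - Rmin eps ((d - c) / 2))) as [x0 Ex0]; [lra |].
    exists x0. intros x Hx. generalize (Hdec x x0 Hx) (Hu x). intros.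
    apply Rabs_def1; lra.
  - destruct (Hsurj (c + Rmin eps ((d - c) / 2))) as [x0 Ex0]; [lra |].
    exists x0. intros x Hx. generalize (Hdec x0 x Hx) (Hu x). intros.
    apply Rabs_def1; lra.
Qed.

Lemma is_lim_dominated (u v : R -> R) (p : Rbar) (l C : R) :
  0 < C -> (forall x, Rabs (v x) <= C * Rabs (u x - l)) ->
  is_lim u p l -> is_lim v p 0.
Proof.
  intros HC Hv Hu. apply is_lim_spec. intros eps.
  assert (He : 0 < eps / C) by (apply Rdiv_lt_0_compat; [apply cond_pos | exact HC]).
  generalize (proj2 (is_lim_spec _ _ _) Hu (mkposreal _ He)).
  apply filter_imp. simpl. intros x Hx. rewrite Rminus_0_r.
  apply (Rle_lt_trans _ _ _ (Hv x)).
  replace (pos eps) with (C * (eps / C)) by (field; lra).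
  apply Rmult_lt_compat_l; assumption.
Qed.

Lemma is_lim_reflect (u : R -> R) (p l : Rbar) :
  is_lim u (Rbar_opp p) l -> is_lim (fun x => u (- x)) p l.
Proof.
  intros H. apply (is_lim_comp u Ropp p l (Rbar_opp p)); [exact H | |].
  - apply (is_lim_opp (fun x => x)), is_lim_id.
  - destruct p as [p | |]; simpl.
    + exists (mkposreal 1 Rlt_0_1). intros y _ Hy E. apply Hy. injection E. lra.
    + exists 0. intros y _. discriminate.
    + exists 0. intros y _. discriminate.
Qed.

Lemma is_derive_reflect (f : R -> R) (x l : R) :
  is_derive f (- x) l -> is_derive (fun x => f (- x)) x (- l).
Proof.
  intros Hf. auto_derive; [exists l; exact Hf |].
  replace (Derive (fun y => f y) (- x)) with l
    by (symmetry; apply is_derive_unique, Hf). ring.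
Qed.

Lemma second_derivative (u v : R -> R) (x w : R) :
  (forall y, is_derive u y (v y)) -> is_derive v x w -> is_derive_n u 2 x w.
Proof.
  intros Hu Hv. apply (is_derive_ext v); [| exact Hv].
  intros y. symmetry. apply is_derive_unique, Hu.
Qed.

Lemma heteroclinic_intro (G : R -> R -> R) (a b : R) (u v : R -> R) :
  (forall x, 0 < u x /\ is_derive u x (v x) /\ is_derive v x (G (u x) (v x))) ->
  G a 0 = 0 -> G b 0 = 0 ->
  is_lim u m_infty a -> is_lim v m_infty 0 -> is_lim u p_infty b -> is_lim v p_infty 0 ->
  heteroclinic G a b u.
Proof.
  intros Huv Ga Gb L1 L2 L3 L4.
  assert (Ev : forall x, v x = Derive u x).
  { intros x. symmetry. apply is_derive_unique, Huv. }
  assert (E2 : forall x, is_derive_n u 2 x (G (u x) (v x))).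
  { intros x. apply (second_derivative u v); [intros y |]; apply Huv. }
  split; [| repeat split; try assumption].
  - intros x. split; [apply Huv |]. split; [exists (v x); apply Huv |].
    split; [exists (G (u x) (v x)); apply E2 |].
    rewrite <- Ev. apply is_derive_n_unique, E2.
  - apply (is_lim_ext v); [exact Ev | exact L2].
  - apply (is_lim_ext v); [exact Ev | exact L4].
Qed.

Lemma profile_bounds_intro (C eps : R) (u v w : R -> R) :
  (forall x, is_derive u x (v x)) -> (forall x, is_derive v x (w x)) ->
  (forall x, Rabs (v x) <= C * eps ^ 2) ->
  (forall x, Rabs (w x) <= C * eps * Rabs (v x)) ->
  profile_bounds C eps u.
Proof.
  intros Hu Hv B1 B2 x.
  rewrite (is_derive_n_unique u 2 x (w x)) by (apply (second_derivative u v); auto).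
  replace (Derive u x) with (v x) by (symmetry; apply is_derive_unique, Hu).
  split; auto.
Qed.

Theorem proposition5 (mu k gamma s Rm : R)
    (hmu : 0 < mu) (hk : 0 < k) (hgamma : 1 <= gamma) (hs : s <> 0) (hRm : 0 < Rm) :
  exists eps0 : R, 0 < eps0 /\
  exists C : R, 0 < C /\
  forall Rp : R, 0 < Rp ->
    (0 < s -> 0 < Rm - Rp < eps0 ->
      exists u : R -> R,
        heteroclinic (profile_rhs gamma mu k s Rm Rp) Rm Rp u /\
        (forall x y : R, x < y -> u y < u x) /\
        (forall x : R, Derive u x < 0) /\
        profile_bounds C (Rabs (Rp - Rm)) u) /\
    (s < 0 -> 0 < Rp - Rm < eps0 ->
      exists u : R -> R,
        heteroclinic (profile_rhs gamma mu k s Rm Rp) Rm Rp u /\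
        (forall x y : R, x < y -> u x < u y) /\
        (forall x : R, 0 < Derive u x) /\
        profile_bounds C (Rabs (Rp - Rm)) u).
Proof.
  set (a := 2 * Rabs s * mu / k ^ 2).
  assert (Hk2 : 0 < k ^ 2) by (apply pow_lt, hk).
  assert (Ha : 0 < a).
  { apply Rdiv_lt_0_compat; [| exact Hk2]. generalize (Rabs_pos_lt s hs). nra. }
  destruct (weak_profile gamma k a Rm hgamma hk Ha hRm) as [eps0 [C [He0 [HC Hprof]]]].
  exists eps0. split; [lra |]. exists C. split; [exact HC |].
  intros Rp HRp. split; intros Hs Hp.
  - destruct (Hprof Rp Rm) as [u [v [Hsurj Huv]]]; [lra .. |].
    assert (Ha' : a = 2 * s * mu / k ^ 2) by (unfold a; rewrite Rabs_pos_eq; lra).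
    assert (EG : forall r p, profile_rhs gamma mu k s Rm Rp r p =
              2 / k ^ 2 * profile_f gamma Rp Rm r - a * p + p ^ 2 / (2 * r)).
    { intros r p. unfold profile_rhs. rewrite <- Ha', profile_f_sym by lra. reflexivity. }
    destruct (profile_f_zeros gamma Rp Rm) as [Z1 Z2]; [lra |].
    assert (Hdec : forall x y, x < y -> u y < u x).
    { intros x y Hxy. apply Ropp_lt_cancel.
      apply (increasing_of_derive (fun x => - u x) (fun x => - v x)); [exact Hxy | |].
      - intros t _. apply (is_derive_opp (V := R_NormedModule)), Huv.
      - intros t _. destruct (Huv t) as [_ [H _]]. lra. }
    destruct (decreasing_onto_limits u Rp Rm) as [L1 L2];
      [lra | exact Hdec | apply Huv | exact Hsurj |].
    exists u. split; [| split; [exact Hdec | split]].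
    + apply (heteroclinic_intro _ _ _ u v).
      * intros x. rewrite EG. destruct (Huv x) as [H1 [_ [H3 [H4 _]]]].
        split; [lra | split; assumption].
      * rewrite EG, Z2. field. lra.
      * rewrite EG, Z1. field. lra.
      * exact L1.
      * apply (is_lim_dominated u v _ Rm C HC); [apply Huv | exact L1].
      * exact L2.
      * apply (is_lim_dominated u v _ Rp C HC); [apply Huv | exact L2].
    + intros x. replace (Derive u x) with (v x); [apply Huv |].
      symmetry. apply is_derive_unique, Huv.
    + rewrite Rabs_minus_sym, Rabs_pos_eq by lra.
      apply (profile_bounds_intro C (Rm - Rp) u v (fun x =>
               2 / k ^ 2 * profile_f gamma Rp Rm (u x) - a * v x + (v x) ^ 2 / (2 * u x)));
        intros x; destruct (Huv x) as [_ [_ [D1 [D2 [B1 [B2 _]]]]]]; assumption.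
  (* Here u decreases from [Rp] to [Rm]. The damping term is the only one odd in R', so reflecting x
     turns the coefficient a into -a, which is the one belonging to s < 0. *)
  - destruct (Hprof Rm Rp) as [u [v [Hsurj Huv]]]; [lra .. |].
    assert (Ha' : - a = 2 * s * mu / k ^ 2).
    { unfold a. rewrite Rabs_left by exact Hs. field. lra. }
    assert (EG : forall r p, profile_rhs gamma mu k s Rm Rp r p =
              2 / k ^ 2 * profile_f gamma Rm Rp r + a * p + p ^ 2 / (2 * r)).
    { intros r p. unfold profile_rhs. rewrite <- Ha'. ring. }
    destruct (profile_f_zeros gamma Rm Rp) as [Z1 Z2]; [lra |].
    set (U := fun x => u (- x)). set (V := fun x => - v (- x)).
    assert (DU : forall x, is_derive U x (V x)).
    { intros x. apply is_derive_reflect, Huv. }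
    assert (EV : forall x, profile_rhs gamma mu k s Rm Rp (U x) (V x) =
              2 / k ^ 2 * profile_f gamma Rm Rp (u (- x)) - a * v (- x)
              + (v (- x)) ^ 2 / (2 * u (- x))).
    { intros x. rewrite EG. unfold U, V, Rdiv. ring. }
    assert (DV : forall x, is_derive V x (profile_rhs gamma mu k s Rm Rp (U x) (V x))).
    { intros x. rewrite EV, <- Ropp_involutive.
      apply (is_derive_opp (V := R_NormedModule) (fun x => v (- x))), is_derive_reflect, Huv. }
    assert (Hinc : forall x y, x < y -> U x < U y).
    { intros x y Hxy. apply (increasing_of_derive U V); [exact Hxy | |].
      - intros t _. apply DU.
      - intros t _. unfold V. destruct (Huv (- t)) as [_ [H _]]. lra. }
    destruct (decreasing_onto_limits u Rm Rp) as [L1 L2].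
    { lra. }
    { intros x y Hxy. generalize (Hinc (- y) (- x) ltac:(lra)).
      unfold U. rewrite !Ropp_involutive. tauto. }
    { apply Huv. } { exact Hsurj. }
    assert (LU1 : is_lim U m_infty Rm) by (apply is_lim_reflect; exact L2).
    assert (LU2 : is_lim U p_infty Rp) by (apply is_lim_reflect; exact L1).
    exists U. split; [| split; [exact Hinc | split]].
    + apply (heteroclinic_intro _ _ _ U V).
      * intros x. split; [| split; [apply DU | apply DV]].
        unfold U. destruct (Huv (- x)) as [H _]. lra.
      * rewrite EG, Z1. field. lra.
      * rewrite EG, Z2. field. lra.
      * exact LU1.
      * apply (is_lim_dominated U V _ Rm C HC); [| exact LU1].
        intros x. unfold V. rewrite Rabs_Ropp. apply Huv.
      * exact LU2.
      * apply (is_lim_dominated U V _ Rp C HC); [| exact LU2].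
        intros x. unfold V. rewrite Rabs_Ropp. apply Huv.
    + intros x. replace (Derive U x) with (V x) by (symmetry; apply is_derive_unique, DU).
      unfold V. destruct (Huv (- x)) as [_ [H _]]. lra.
    + rewrite Rabs_pos_eq by lra.
      apply (profile_bounds_intro C (Rp - Rm) U V
               (fun x => profile_rhs gamma mu k s Rm Rp (U x) (V x)) DU DV).
      * intros x. unfold V. rewrite Rabs_Ropp. apply Huv.
      * intros x. rewrite EV. unfold V. rewrite Rabs_Ropp. apply Huv.
Qed.
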